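(* For any computable group $(G,\nu)$ the family $\mathfrak{W}_{BT}$ of witnesses of the Banach-Tarski paradox belongs to the class $\Sigma^0_2$. If, in addition, $G$ is fully residually free, then the family $\mathfrak{W}_{BT}$ is computable.
   Context: A numbered group is a pair $(G,\nu)$ with $G$ a countable group and $\nu:\mathbb{N}\to G$ a surjection. It is computable if $\{(i,j,k)\in\mathbb{N}^3:\nu(i)\nu(j)=\nu(k)\}$ is a computable (decidable) set. For a group $G$, $\mathfrak{W}_{BT}$ is the family of all finite subsets $K\subset G$ for which there is a natural number $n\ge1$ such that for every non-empty finite $F\subset G$ there is $k\in K$ with $\frac{|F\setminus kF|}{|F|}\ge\frac1n$. Finite subsets of $\mathbb{N}$ are identified with their G\''odel numbers (canonical indices), and finite subsets of $G$ are represented by finite sets of $\nu$-numbers of their elements. Thus $\mathfrak{W}_{BT}$ being in $\Sigma^0_2$ (arithmetical hierarchy), respectively computable, means that the set of (G\''odel numbers of) finite $D\subset\mathbb{N}$ with $\nu(D)\in\mathfrak{W}_{BT}$ is $\Sigma^0_2$, respectively computable. A group $G$ is fully residually free if for any finite collection of nontrivial elements $g_1,\ldots,g_m\in G\setminus\{1\}$ there exists a homomorphism $\phi$ from $G$ onto a free group such that $\phi(g_1)\ne1,\ldots,\phi(g_m)\ne1$. *)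

(* Defs.v *)
From HB Require Import structures.
From mathcomp Require Import all_boot all_order all_algebra.
From mathcomp Require Import finmap.

Set Implicit Arguments.
Unset Strict Implicit.
Unset Printing Implicit Defensive.

Import Order.TTheory GRing.Theory Num.Theory.

(* Total recursive functions, as the least class of total functions N^k -> N
   containing the initial functions and closed under composition, primitive
   recursion and minimization of regular functions.  The last two constructors
   take the function so defined as an argument, specified by its defining
   equations. *)
Inductive recursive : forall k : nat, (k.-tuple nat -> nat) -> Prop :=
| recursive_zero k : recursive (fun _ : k.-tuple nat => 0)
| recursive_succ : recursive (fun x : 1.-tuple nat => (thead x).+1)
| recursive_proj k (i : 'I_k) : recursive (fun x : k.-tuple nat => tnth x i)
| recursive_comp k m (f : m.-tuple nat -> nat)
    (g : 'I_m -> k.-tuple nat -> nat) :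
    recursive f -> (forall i, recursive (g i)) ->
    recursive (fun x : k.-tuple nat => f [tuple g i x | i < m])
| recursive_prim k (f : k.-tuple nat -> nat) (g : k.+2.-tuple nat -> nat)
    (h : k.+1.-tuple nat -> nat) :
    recursive f -> recursive g ->
    (forall x : k.-tuple nat, h [tuple of 0 :: x] = f x) ->
    (forall n (x : k.-tuple nat),
       h [tuple of n.+1 :: x] = g [tuple of n :: h [tuple of n :: x] :: x]) ->
    recursive h
| recursive_mu k (f : k.+1.-tuple nat -> nat) (g : k.-tuple nat -> nat) :
    recursive f ->
    (forall x : k.-tuple nat, f [tuple of g x :: x] = 0) ->
    (forall (x : k.-tuple nat) n, n < g x -> f [tuple of n :: x] <> 0) ->
    recursive g.

Definition computable k (A : k.-tuple nat -> Prop) : Prop :=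
  exists2 b : k.-tuple nat -> bool,
    recursive (fun x => nat_of_bool (b x)) & forall x, A x <-> b x.

Definition sigma02 k (A : k.-tuple nat -> Prop) : Prop :=
  exists2 R : k.+2.-tuple nat -> Prop,
    computable R &
    forall x : k.-tuple nat,
      A x <-> exists n, forall m, R [tuple of n :: m :: x].

(* The finite set with canonical index e = \sum_(i in D) 2 ^ i. *)
Definition canonical_set (e : nat) : {fset nat} :=
  [fset i in iota 0 e | odd (e %/ 2 ^ i)]%fset.

Definition numbering (T : Type) (nu : nat -> T) : Prop :=
  forall g, exists i, nu i = g.

Definition computable_group (G : groupType) (nu : nat -> G) : Prop :=
  computable (fun t : 3.-tuple nat =>
    (nu (tnth t (inord 0)) * nu (tnth t (inord 1)))%g
      = nu (tnth t (inord 2))).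

Definition index_set (G : groupType) (nu : nat -> G) (W : {fset G} -> Prop) :
    1.-tuple nat -> Prop :=
  fun t => W [fset nu i | i in canonical_set (thead t)]%fset.

Definition translate (G : groupType) (k : G) (F : {fset G}) : {fset G} :=
  [fset (k * x)%g | x in F]%fset.

Definition W_BT (G : groupType) (K : {fset G}) : Prop :=
  exists2 n : nat, 0 < n &
    forall F : {fset G}, F <> fset0 ->
      exists2 k, k \in K &
        ((n%:R^-1 : rat)
           <= #|` (F `\` translate k F)%fset |%:R / #|` F |%:R)%R.

(* Freeness on some basis, by the universal property. *)
Definition free_group (F : groupType) : Prop :=
  exists (X : Type) (iota : X -> F),
    forall (H : groupType) (f : X -> H),
      exists2 phi : {multiplicative F -> H},
        forall x, phi (iota x) = f x &
        forall psi : {multiplicative F -> H},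
          (forall x, psi (iota x) = f x) -> psi =1 phi.

Definition fully_residually_free (G : groupType) : Prop :=
  forall s : seq G, (forall g, g \in s -> g <> 1%g) ->
    exists (F : groupType) (phi : {multiplicative G -> F}),
      [/\ free_group F, forall y, exists x, phi x = y
        & forall g, g \in s -> phi g <> 1%g].

(* Main.v *)
Require Import Defs.
From HB Require Import structures.
From mathcomp Require Import all_boot all_order all_algebra.
From mathcomp Require Import finmap.
From mathcomp Require Import boolp.
From mathcomp Require Import zify.

Set Implicit Arguments.
Unset Strict Implicit.
Unset Printing Implicit Defensive.

Import Order.TTheory GRing.Theory Num.Theory.

(** For the first part, it is enough to test the isoperimetric inequality
    #|F| <= n * #|F `\` k F| on sets F = nu D with nu injective on D, for then
    both cardinals are sums over D decided by the multiplication table; the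
    family is thus defined by a formula of the shape
    (exists n, forall D, decidable condition), see [index_set_W_BTE].

    For the second part, a finite subset K of a fully residually free group is
    a witness of the paradox if and only if two of its members do not commute,
    which is decidable.

    If K is commutative ([commuting_not_W_BT]), the sets of products of powers
    of members of K with exponents below m grow polynomially with m, whereas
    the isoperimetric inequality would make them grow exponentially.

    If a and b in K do not commute ([noncommuting_W_BT]), their commutator
    survives in a free group, and free groups embed in groups of reduced words
    ([free_group_embed]); hence there is a morphism theta to a group of reduced
    words such that theta a and theta b do not commute.  There, two facts on
    longest common prefixes hold.
    - If w shares a prefix of length L = 4 max(|a|, |b|) with both a w and b w,
      then a and b commute, since each of them shifts that prefix along itself
      ([long_lcp_commute]).
    - Along an orbit i |-> a^i w with a <> 1, consecutive points share fewer
      than L letters only for boundedly many i, uniformly in w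
      ([branch_window]); this follows from the strict growth of the lengths
      of the powers of a conjugate of a ([wlen_expS]).
    By the second fact and averaging over orbits ([orbit_count]), in a finite
    set F almost invariant under a, the g such that theta g and theta (a g)
    share fewer than L letters are fewer than half of F; likewise for b.  By
    the first fact these two subsets cover F, a contradiction. *)

(** * Closure properties of recursive functions *)

Lemma eq_recursive k (f g : k.-tuple nat -> nat) :
  f =1 g -> recursive f -> recursive g.
Proof. by move=> /funext ->. Qed.

(** Closure under substitution of a tuple of recursive functions. *)
Lemma recursive_subst k m (f : m.-tuple nat -> nat)
    (g : k.-tuple nat -> m.-tuple nat) :
  recursive f -> (forall i, recursive (fun x => tnth (g x) i)) ->
  recursive (fun x => f (g x)).
Proof.
move=> rf rg; apply: eq_recursive (recursive_comp rf rg) => x /=.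
by congr f; apply: eq_from_tnth => i; rewrite tnth_mktuple.
Qed.

Lemma recursive_behead k (f : k.-tuple nat -> nat) :
  recursive f -> recursive (fun y : k.+1.-tuple nat => f [tuple of behead y]).
Proof.
move=> rf; apply: (recursive_subst rf) => i.
apply: eq_recursive (recursive_proj (lift ord0 i)) => y /=.
by rewrite !(tnth_nth 0) nth_behead.
Qed.

Lemma recursive_cons k (f : k.+1.-tuple nat -> nat) (g : k.-tuple nat -> nat) :
  recursive f -> recursive g -> recursive (fun x => f [tuple of g x :: x]).
Proof.
move=> rf rg; apply: (recursive_subst rf) => i.
case: (unliftP ord0 i) => [j|] ->.
  by apply: eq_recursive (recursive_proj j) => y /=; rewrite tnthS.
by apply: eq_recursive rg => y; rewrite tnth0.
Qed.

Lemma recursive_thead k : recursive (fun y : k.+1.-tuple nat => thead y).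
Proof. exact: recursive_proj. Qed.

Lemma tuple_beheadK k a (x : k.-tuple nat) :
  [tuple of behead [tuple of a :: x]] = x.
Proof. exact: val_inj. Qed.

(** Primitive recursion whose number of steps is itself a recursive function
    of the parameters.  In the hypothesis on [G], the tuple lists the step, the
    previous value and the parameters, in this order. *)
Lemma recursive_iter k (f : k.-tuple nat -> nat)
    (G : nat -> nat -> k.-tuple nat -> nat) (n : k.-tuple nat -> nat) :
  recursive f ->
  recursive (fun y : k.+2.-tuple nat =>
    G (thead y) (thead [tuple of behead y])
      [tuple of behead [tuple of behead y]]) ->
  recursive n ->
  recursive (fun x => nat_rect (fun=> nat) (f x) (fun i r => G i r x) (n x)).
Proof.
move=> rf rG rn.
pose h (y : k.+1.-tuple nat) := nat_rect (fun=> nat) (f [tuple of behead y])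
  (fun i r => G i r [tuple of behead y]) (thead y).
have rh : recursive h.
  apply: (recursive_prim rf rG) => [x|a x].
    by rewrite /h theadE tuple_beheadK.
  by rewrite /h !(theadE, tuple_beheadK).
apply: eq_recursive (recursive_cons rh rn) => x.
by rewrite /h tuple_beheadK theadE.
Qed.

Lemma recursive_const k c : recursive (fun _ : k.-tuple nat => c).
Proof.
elim: c => [|c IHc]; first exact: recursive_zero.
apply: (@recursive_subst k 1 _ (fun=> [tuple c]) recursive_succ) => i.
by rewrite ord1.
Qed.

Lemma recursive_S k (f : k.-tuple nat -> nat) :
  recursive f -> recursive (fun x => (f x).+1).
Proof.
move=> rf; apply: (@recursive_subst k 1 _ (fun x => [tuple f x]) recursive_succ).
by move=> i; rewrite ord1.
Qed.

Lemma recursive_add k (f g : k.-tuple nat -> nat) :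
  recursive f -> recursive g -> recursive (fun x => f x + g x).
Proof.
move=> rf rg; apply: eq_recursive (recursive_iter (G := fun _ r _ => r.+1) rf _ rg).
  by move=> x; elim: (g x) => [|n IHn]; rewrite ?addn0 // addnS -IHn.
exact/recursive_S/recursive_behead/recursive_thead.
Qed.

Lemma recursive_mul k (f g : k.-tuple nat -> nat) :
  recursive f -> recursive g -> recursive (fun x => f x * g x).
Proof.
move=> rf rg; pose G (i r : nat) (x : k.-tuple nat) := r + f x.
apply: eq_recursive (recursive_iter (G := G) (recursive_const _ 0) _ rg).
  by move=> x; elim: (g x) => [|n IHn]; rewrite ?muln0 // mulnS addnC -IHn.
apply: recursive_add; first exact/recursive_behead/recursive_thead.
exact: (recursive_behead (recursive_behead rf)).
Qed.

Lemma recursive_pred k (f : k.-tuple nat -> nat) :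
  recursive f -> recursive (fun x => (f x).-1).
Proof.
move=> rf.
apply: eq_recursive (recursive_iter (G := fun i _ _ => i) (recursive_const _ 0)
  (recursive_thead _) rf).
by move=> x; case: (f x).
Qed.

Lemma recursive_sub k (f g : k.-tuple nat -> nat) :
  recursive f -> recursive g -> recursive (fun x => f x - g x).
Proof.
move=> rf rg; apply: eq_recursive (recursive_iter (G := fun _ r _ => r.-1) rf _ rg).
  by move=> x; elim: (g x) => [|n IHn]; rewrite ?subn0 // subnS -IHn.
exact/recursive_pred/recursive_behead/recursive_thead.
Qed.

(** A boolean predicate is decidable when its indicator function is recursive. *)
Definition decidable_pred k (b : k.-tuple nat -> bool) :=
  recursive (fun x => nat_of_bool (b x)).

Lemma decidable_leq k (f g : k.-tuple nat -> nat) :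
  recursive f -> recursive g -> decidable_pred (fun x => f x <= g x).
Proof.
move=> rf rg; apply: (@eq_recursive _ (fun x => 1 - (f x - g x))).
  by move=> x; rewrite /leq; case: (f x - g x).
exact/recursive_sub/recursive_sub/rg/rf/recursive_const.
Qed.

Lemma decidable_not k (b : k.-tuple nat -> bool) :
  decidable_pred b -> decidable_pred (fun x => ~~ b x).
Proof.
move=> rb; apply: eq_recursive (recursive_sub (recursive_const _ 1) rb).
by move=> x; case: (b x).
Qed.

Lemma decidable_and k (b c : k.-tuple nat -> bool) :
  decidable_pred b -> decidable_pred c -> decidable_pred (fun x => b x && c x).
Proof.
move=> rb rc; apply: eq_recursive (recursive_mul rb rc).
by move=> x; rewrite mulnb.
Qed.

Lemma decidable_or k (b c : k.-tuple nat -> bool) :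
  decidable_pred b -> decidable_pred c -> decidable_pred (fun x => b x || c x).
Proof.
move=> rb rc.
apply: eq_recursive (decidable_not (decidable_and (decidable_not rb) (decidable_not rc))).
by move=> x; rewrite negb_and !negbK.
Qed.

Lemma decidable_implies k (b c : k.-tuple nat -> bool) :
  decidable_pred b -> decidable_pred c -> decidable_pred (fun x => b x ==> c x).
Proof.
move=> rb rc; apply: eq_recursive (decidable_or (decidable_not rb) rc).
by move=> x; rewrite implybE.
Qed.

Lemma decidable_eq k (f g : k.-tuple nat -> nat) :
  recursive f -> recursive g -> decidable_pred (fun x => f x == g x).
Proof.
move=> rf rg.
apply: eq_recursive (decidable_and (decidable_leq rf rg) (decidable_leq rg rf)).
by move=> x; rewrite eqn_leq.
Qed.

Lemma recursive_sum k (F : nat -> k.-tuple nat -> nat) (n : k.-tuple nat -> nat) :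
  recursive n ->
  recursive (fun y : k.+1.-tuple nat => F (thead y) [tuple of behead y]) ->
  recursive (fun x => \sum_(i < n x) F i x).
Proof.
move=> rn rF; pose G i r x := r + F i x.
apply: eq_recursive (recursive_iter (G := G) (recursive_const _ 0) _ rn).
  move=> x; elim: (n x) => [|m IHm]; rewrite ?big_ord0 ?big_ord_recr //=.
  by rewrite -IHm.
apply: recursive_add; first exact/recursive_behead/recursive_thead.
pose g (y : k.+2.-tuple nat) :=
  [tuple of thead y :: [tuple of behead [tuple of behead y]]].
have rg i : recursive (fun y => tnth (g y) i).
  case: (unliftP ord0 i) => [j|] ->.
    apply: eq_recursive (recursive_behead (recursive_behead (recursive_proj j))).
    by move=> y; rewrite tnthS.
  by apply: eq_recursive (@recursive_thead _) => y; rewrite tnth0.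
apply: eq_recursive (recursive_subst rF rg) => y.
by rewrite /g theadE tuple_beheadK.
Qed.

Lemma decidable_exists k (P : nat -> k.-tuple nat -> bool)
    (n : k.-tuple nat -> nat) :
  recursive n ->
  decidable_pred (fun y : k.+1.-tuple nat => P (thead y) [tuple of behead y]) ->
  decidable_pred (fun x => [exists i : 'I_(n x), P i x]).
Proof.
move=> rn rP.
apply: eq_recursive (decidable_not (decidable_leq
  (recursive_sum (F := fun i x => P i x) rn rP) (recursive_const _ 0))).
move=> x; congr (nat_of_bool _); rewrite leqn0 sum_nat_eq0 negb_forall.
by apply: eq_existsb => i; case: (P i x).
Qed.

Lemma decidable_forall k (P : nat -> k.-tuple nat -> bool)
    (n : k.-tuple nat -> nat) :
  recursive n ->
  decidable_pred (fun y : k.+1.-tuple nat => P (thead y) [tuple of behead y]) ->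
  decidable_pred (fun x => [forall i : 'I_(n x), P i x]).
Proof.
move=> rn rP; apply: eq_recursive (decidable_not
  (decidable_exists (P := fun i x => ~~ P i x) rn (decidable_not rP))).
move=> x; rewrite negb_exists; congr (nat_of_bool _).
by apply: eq_forallb => i; rewrite negbK.
Qed.

(** The binary digit of weight 2 ^ i of e, that is, membership of i in the finite
    set with canonical index e. *)
Definition bit (i e : nat) : bool := odd (e %/ 2 ^ i).

Lemma decidable_odd k (f : k.-tuple nat -> nat) :
  recursive f -> decidable_pred (fun x => odd (f x)).
Proof.
move=> rf; apply: eq_recursive (recursive_iter (G := fun i r x => 1 - r)
  (recursive_const _ 0) _ rf).
  by move=> x; elim: (f x) => //= n ->; case: odd.
apply: recursive_sub; first exact: recursive_const.
exact/recursive_behead/recursive_thead.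
Qed.

Lemma recursive_half k (f : k.-tuple nat -> nat) :
  recursive f -> recursive (fun x => (f x)./2).
Proof.
move=> rf; apply: eq_recursive (recursive_iter (G := fun i r x => odd i + r)
  (recursive_const _ 0) _ rf).
  by move=> x; elim: (f x) => //= n ->; rewrite uphalf_half.
apply: recursive_add; first exact/decidable_odd/recursive_thead.
exact/recursive_behead/recursive_thead.
Qed.

Lemma decidable_bit k (f g : k.-tuple nat -> nat) :
  recursive f -> recursive g -> decidable_pred (fun x => bit (f x) (g x)).
Proof.
move=> rf rg; apply: decidable_odd.
apply: eq_recursive (recursive_iter (G := fun i r x => r./2) rg _ rf).
  move=> x; elim: (f x) => [|n IHn]; first by rewrite divn1.
  by rewrite expnSr divnMA divn2 -IHn.
exact/recursive_half/recursive_behead/recursive_thead.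
Qed.

(** * Canonical indices of finite sets *)

Lemma in_canonical_set i e : (i \in canonical_set e) = bit i e.
Proof.
rewrite !inE /= mem_iota /= add0n /bit; case: ltnP => //= le_ei.
by rewrite divn_small // (leq_ltn_trans le_ei) // ltn_expl.
Qed.

Lemma in_canonical_filter e (P : pred nat) i :
  (i \in [fset i in canonical_set e | P i]%fset) = bit i e && P i.
Proof. by rewrite -in_canonical_set !inE. Qed.

Lemma bit_lt i e : bit i e -> i < e.
Proof. by rewrite -in_canonical_set !inE /= mem_iota => /andP[]. Qed.

Lemma canonical_set_surj (D : {fset nat}) : exists e, canonical_set e = D.
Proof.
have bits (p : pred nat) n : exists e, forall j, bit j e = (j < n) && p j.
  elim: n p => [|n IHn] p.
    by exists 0 => j; rewrite /bit div0n.
  have [e He] := IHn (p \o succn); exists (p 0 + e.*2) => -[|j].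
    by rewrite /bit divn1 oddD odd_double addbF; case: (p 0).
  by rewrite /bit expnS divnMA divn2 half_bit_double -/(bit j e) He.
have [e He] := bits (mem D) (\max_(i <- D) i).+1.
exists e; apply/fsetP => j; rewrite in_canonical_set He ltnS.
rewrite andb_idl //= => jD.
by rewrite (big_fsetD1 j) //= leq_maxl.
Qed.

Lemma card_canonical_set e (P : pred nat) :
  #|` [fset i in canonical_set e | P i]%fset| = \sum_(i < e) (bit i e && P i).
Proof.
rewrite -(big_mkord xpredT (fun i => nat_of_bool (bit i e && P i))).
rewrite -big_mkcond /= sum1_count -size_filter /index_iota subn0.
apply/perm_size/uniq_perm => [||i]; first exact: fset_uniq.
  by rewrite filter_uniq // iota_uniq.
rewrite mem_filter mem_iota /= add0n andb_idr; last by case/andP => /bit_lt.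
by rewrite -(in_canonical_set i e) !inE /=.
Qed.

(** The definition of a witness without fractions; n.+1 stands for the positive
    integer n. *)
Lemma W_BTE (G : groupType) (K : {fset G}) :
  W_BT K <-> exists n, forall F : {fset G}, F <> fset0 ->
    exists2 k, k \in K & #|` F| <= n.+1 * #|` F `\` translate k F|%fset.
Proof.
have ratio (F : {fset G}) n r : F <> fset0 ->
    ((n.+1%:R^-1 : rat) <= r%:R / #|` F|%:R)%R = (#|` F| <= n.+1 * r).
  move/eqP; rewrite -cardfs_gt0 => F_gt0.
  rewrite ler_pdivlMr ?ltr0n // mulrC ler_pdivrMr ?ltr0n //.
  by rewrite -natrM ler_nat mulnC.
split=> [[[//|n] _ Hn]|[n Hn]]; [exists n|exists n.+1 => //].
  by move=> F F0; have [k kK] := Hn F F0; rewrite ratio //; exists k.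
by move=> F F0; have [k kK] := Hn F F0; rewrite -(ratio F) //; exists k.
Qed.

(** * Arithmetical definitions over a computable numbered group *)

(** The multiplication table of a computable numbered group, as a boolean
    relation that is recursive in all its arguments. *)
Definition decidable_table (G : groupType) (nu : nat -> G)
    (M : nat -> nat -> nat -> bool) :=
  (forall i j k, M i j k <-> (nu i * nu j = nu k)%g) /\
  (forall m (f g h : m.-tuple nat -> nat),
     recursive f -> recursive g -> recursive h ->
     decidable_pred (fun x => M (f x) (g x) (h x))).

Lemma computable_group_table (G : groupType) (nu : nat -> G) :
  computable_group nu -> exists M, decidable_table nu M.
Proof.
case=> b rb Hb; exists (fun i j k => b [tuple i; j; k]); split.
  by move=> i j k; rewrite -Hb !(tnth_nth 0) !inordK.
move=> m f g h rf rg rh.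
apply: (@recursive_subst _ _ _ (fun x => [tuple f x; g x; h x]) rb).
by case=> [[|[|[]]]].
Qed.

(** nu i belongs to the translate by nu k of nu D_m, where D_m is the set with
    canonical index m. *)
Definition in_translate (M : nat -> nat -> nat -> bool) (k m i : nat) :=
  [exists j : 'I_m, bit j m && M k j i].

(** nu is injective on D_m; here u is an index of the unit, so that M u i j
    tests the equality of nu i and nu j. *)
Definition inj_numbering (M : nat -> nat -> nat -> bool) (u m : nat) :=
  [forall i : 'I_m, forall j : 'I_m,
     [&& bit i m, bit j m & M u i j] ==> (i == j :> nat)].

(** The number of elements of D_m. *)
Definition card_set (m : nat) := \sum_(i < m) bit i m.

(** The number of i in D_m such that nu i is outside the translate by nu k of
    nu D_m. *)
Definition card_diff_translate (M : nat -> nat -> nat -> bool) (k m : nat) :=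
  \sum_(i < m) (bit i m && ~~ in_translate M k m i).

(** The decidable matrix of the Sigma02 definition: if nu is injective on D_m
    and D_m is not empty, then some k in D_e satisfies
    #|F| <= n.+1 * #|F `\` (nu k) F| for F = nu D_m. *)
Definition displaced (M : nat -> nat -> nat -> bool) (u n m e : nat) :=
  (inj_numbering M u m && (0 < card_set m)) ==>
  [exists k : 'I_e, bit k e && (card_set m <= n.+1 * card_diff_translate M k m)].

Lemma decidable_displaced (G : groupType) (nu : nat -> G) M u k
    (n m e : k.-tuple nat -> nat) :
  decidable_table nu M -> recursive n -> recursive m -> recursive e ->
  decidable_pred (fun x => displaced M u (n x) (m x) (e x)).
Proof.
case=> _ dM rn rm re.
have r0 l : recursive (fun y : l.+1.-tuple nat => thead y).
  exact: recursive_thead.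
have rB l (f : l.-tuple nat -> nat) (rf : recursive f) := recursive_behead rf.
have rcard l (f : l.-tuple nat -> nat) : recursive f ->
    recursive (fun x => card_set (f x)).
  move=> rf; apply: (recursive_sum (F := fun i x => bit i (f x)) rf).
  exact: decidable_bit (r0 _) (rB _ _ rf).
have rdiff l (f g : l.-tuple nat -> nat) : recursive f -> recursive g ->
    recursive (fun x => card_diff_translate M (f x) (g x)).
  move=> rf rg; apply: (recursive_sum
    (F := fun i x => bit i (g x) && ~~ in_translate M (f x) (g x) i) rg).
  apply: decidable_and; first exact: decidable_bit (r0 _) (rB _ _ rg).
  apply: decidable_not; rewrite /in_translate.
  refine (@decidable_exists l.+1
    (fun j y => bit j (g [tuple of behead y]) &&
                M (f [tuple of behead y]) j (thead y)) _ (rB _ _ rg) _).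
  apply: decidable_and.
    exact: decidable_bit (r0 _) (rB _ _ (rB _ _ rg)).
  exact: dM (rB _ _ (rB _ _ rf)) (r0 _) (rB _ _ (r0 _)).
apply: decidable_implies.
  apply: decidable_and; last exact: decidable_leq (recursive_const _ 1) (rcard _ _ rm).
  refine (@decidable_forall _ (fun i x => [forall j : 'I_(m x),
     [&& bit i (m x), bit j (m x) & M u i j] ==> (i == j :> nat)]) _ rm _).
  refine (@decidable_forall k.+1 (fun j y =>
     [&& bit (thead y) (m [tuple of behead y]), bit j (m [tuple of behead y])
       & M u (thead y) j] ==> (thead y == j)) _ (rB _ _ rm) _).
  have rm2 := rB _ _ (rB _ _ rm); have r1 := rB _ _ (r0 k).
  apply: decidable_implies; last exact: decidable_eq.
  apply: decidable_and; first exact: decidable_bit.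
  apply: decidable_and; first exact: decidable_bit.
  exact: dM (recursive_const _ u) r1 (r0 _).
refine (@decidable_exists _ (fun i x => bit i (e x) &&
  (card_set (m x) <= (n x).+1 * card_diff_translate M i (m x))) _ re _).
apply: decidable_and; first exact: decidable_bit (r0 _) (rB _ _ re).
apply: decidable_leq; first exact: rB _ _ (rcard _ _ rm).
apply: recursive_mul; first exact: rB _ _ (recursive_S rn).
exact: rdiff _ _ _ (r0 _) (rB _ _ rm).
Qed.

Lemma imfset_inj_card (G : groupType) (nu : nat -> G) m (P : pred nat) :
  {in canonical_set m &, injective nu} ->
  #|` [fset nu i | i in [fset i in canonical_set m | P i]]%fset|
    = \sum_(i < m) (bit i m && P i).
Proof.
move=> inj; rewrite card_in_imfset /= ?card_canonical_set //.
by move=> i j; rewrite !inE /= => /andP[Hi _] /andP[Hj _]; apply: inj; rewrite !inE.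
Qed.

(** Sets on which nu is injective suffice, because every finite subset of the
    group is the image of such a set under a section of nu. *)
Lemma index_set_W_BTE (G : groupType) (nu : nat -> G) M u e :
  numbering nu -> decidable_table nu M -> nu u = 1%g ->
  W_BT [fset nu i | i in canonical_set e]%fset <->
  exists n, forall m, displaced M u n m e.
Proof.
move=> nu_surj [HM _] nu_u.
have injP m : inj_numbering M u m <-> {in canonical_set m &, injective nu}.
  split=> [/forallP H i j|inj].
    rewrite !in_canonical_set => bi bj eq_ij; have lti := bit_lt bi.
    have /forallP/(_ (Ordinal (bit_lt bj))) := H (Ordinal lti).
    rewrite /= bi bj /= => /implyP H'; apply/eqP/H'/HM.
    by rewrite nu_u mul1g.
  apply/forallP => i; apply/forallP => j; apply/implyP => /and3P[bi bj /HM].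
  by rewrite nu_u mul1g => /inj ->; rewrite ?in_canonical_set.
have card_img m : {in canonical_set m &, injective nu} ->
    #|` [fset nu i | i in canonical_set m]%fset| = card_set m.
  move=> inj; have := imfset_inj_card predT inj.
  rewrite /card_set; under eq_bigr do rewrite andbT; move=> <-; congr #|` _|.
  by apply/fsetP => x; apply/imfsetP/imfsetP => -[i /= iD ->]; exists i;
    move: iD; rewrite ?inE ?andbT.
have card_dif m k : {in canonical_set m &, injective nu} ->
    let F := [fset nu i | i in canonical_set m]%fset in
    #|` F `\` translate (nu k) F|%fset = card_diff_translate M k m.
  move=> inj F.
  rewrite -[RHS](imfset_inj_card (fun i => ~~ in_translate M k m i) inj).
  have trP i : nu i \in translate (nu k) F <-> in_translate M k m i.
    split=> [/imfsetP[_ /= /imfsetP[j /= jD ->] eq_i]|].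
      have bj : bit j m by rewrite -in_canonical_set.
      by apply/existsP; exists (Ordinal (bit_lt bj)); rewrite bj; apply/HM.
    case/existsP => j /andP[bj /HM eq_i]; apply/imfsetP; exists (nu j) => //=.
    by apply/imfsetP; exists (j : nat) => //=; rewrite in_canonical_set.
  congr #|` _|; apply/fsetP => x; rewrite inE.
  apply/andP/imfsetP => [[xN /imfsetP[i /= iD eq_x]]|[i /= iD ->]].
    exists i => //; rewrite [_ \in _]in_canonical_filter -in_canonical_set iD.
    by apply: contra xN => /trP; rewrite eq_x.
  move: iD; rewrite [_ \in _]in_canonical_filter -in_canonical_set => /andP[iD iN].
  split; last by apply/imfsetP; exists i.
  by apply: contra iN => /trP.
rewrite W_BTE; split=> -[n Hn]; exists n.
  move=> m; apply/implyP => /andP[/injP inj D0].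
  have [|k /imfsetP[i /= iD ->]] := Hn [fset nu i | i in canonical_set m]%fset.
    by apply/eqP; rewrite -cardfs_gt0 card_img.
  rewrite card_img // card_dif // => le_n; rewrite in_canonical_set in iD.
  by apply/existsP; exists (Ordinal (bit_lt iD)); rewrite iD.
move=> F /eqP; rewrite -cardfs_gt0 => F0.
have [s nus] := choice nu_surj.
have [m Dm] := canonical_set_surj [fset s x | x in F]%fset.
have inj : {in canonical_set m &, injective nu}.
  by rewrite Dm => _ _ /imfsetP[x /= _ ->] /imfsetP[y /= _ ->]; rewrite !nus => ->.
have eqF : F = [fset nu i | i in canonical_set m]%fset.
  apply/fsetP => x; rewrite Dm; apply/idP/imfsetP => [xF|[_ /= /imfsetP[y /= yF ->] ->]].
    by exists (s x); rewrite ?nus //; apply/imfsetP; exists x.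
  by rewrite nus.
have := Hn m; rewrite /displaced; have /injP -> := inj; rewrite -card_img // -eqF F0 /=.
case/existsP=> k /andP[bk]; rewrite -card_dif // -eqF => le_n; exists (nu k) => //.
by apply/imfsetP; exists (k : nat); rewrite //= in_canonical_set.
Qed.

Lemma sigma02_W_BT (G : groupType) (nu : nat -> G) M :
  numbering nu -> decidable_table nu M -> sigma02 (index_set nu (@W_BT G)).
Proof.
move=> nu_surj tM; have [u nu_u] := nu_surj 1%g.
pose R (x : 3.-tuple nat) :=
  displaced M u (tnth x ord0) (tnth x (inord 1)) (tnth x (inord 2)).
exists (fun x => R x).
  exists R => //; apply: (decidable_displaced _ tM); exact: recursive_proj.
move=> x; rewrite /index_set (index_set_W_BTE _ nu_surj tM nu_u).
have E n m : R [tuple of n :: m :: x] = displaced M u n m (thead x).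
  by rewrite /R /thead !(tnth_nth 0) !inordK.
by split=> -[n Hn]; exists n => m; move: (Hn m); rewrite E.
Qed.

(** Some i and j in D_e satisfy nu j * nu i <> nu i * nu j, where p i j is an
    index of nu i * nu j. *)
Definition noncommuting (M : nat -> nat -> nat -> bool) (p : nat -> nat -> nat)
    (e : nat) :=
  [exists i : 'I_e, exists j : 'I_e, [&& bit i e, bit j e & ~~ M j i (p i j)]].

Lemma computable_noncommuting (G : groupType) (nu : nat -> G) M :
  numbering nu -> decidable_table nu M ->
  computable (index_set nu (fun K =>
    exists a b, [/\ a \in K, b \in K & (a * b <> b * a)%g])).
Proof.
move=> nu_surj [HM dM].
have ex_p i j : exists k, M i j k.
  by have [k /esym/HM] := nu_surj (nu i * nu j)%g; exists k.
(* The index of a product is found by unbounded search. *)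
pose p i j := ex_minn (ex_p i j).
have Mp i j : M i j (p i j) by rewrite /p; case: ex_minnP.
have rp l (f g : l.-tuple nat -> nat) : recursive f -> recursive g ->
    recursive (fun x => p (f x) (g x)).
  move=> rf rg.
  apply: (recursive_mu (f := fun y : l.+1.-tuple nat =>
    ~~ M (f [tuple of behead y]) (g [tuple of behead y]) (thead y))).
  - apply: decidable_not; apply: dM; [exact: recursive_behead.. |].
    exact: recursive_thead.
  - by move=> x; rewrite tuple_beheadK theadE Mp.
  move=> x n; rewrite tuple_beheadK theadE /p; case: ex_minnP => q _ min_q.
  by case: (boolP (M _ _ n)) => // /min_q; rewrite ltnNge => ->.
exists (fun t => noncommuting M p (thead t)).
  have r0 l := recursive_thead l.
  have rt2 := recursive_behead (recursive_behead (r0 0)).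
  have r1 := recursive_behead (r0 1).
  refine (@decidable_exists _ (fun i t => [exists j : 'I_(thead t),
    [&& bit i (thead t), bit j (thead t) & ~~ M j i (p i j)]]) _ (r0 _) _).
  refine (@decidable_exists 2 (fun j y =>
    [&& bit (thead y) (thead [tuple of behead y]),
        bit j (thead [tuple of behead y]) & ~~ M j (thead y) (p (thead y) j)])
    _ (recursive_behead (r0 _)) _).
  apply: decidable_and; first exact: decidable_bit.
  apply: decidable_and; first exact: decidable_bit (r0 _) rt2.
  by apply: decidable_not; apply: dM => //; apply: rp.
move=> t; rewrite /index_set; set e := thead t; split.
  case=> a [b [/imfsetP[i /= iD ->] /imfsetP[j /= jD ->] nab]].
  rewrite !in_canonical_set in iD jD.
  apply/existsP; exists (Ordinal (bit_lt iD)).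
  apply/existsP; exists (Ordinal (bit_lt jD)); rewrite /= iD jD /=.
  by apply/negP => /HM; have /HM <- := Mp i j => /esym.
case/existsP=> i /existsP[j /and3P[iD jD nM]]; exists (nu i), (nu j); split.
- by apply/imfsetP; exists (i : nat); rewrite //= in_canonical_set.
- by apply/imfsetP; exists (j : nat); rewrite //= in_canonical_set.
move=> eq_ij; case/negP: nM; apply/HM; rewrite -eq_ij.
by apply/HM.
Qed.

(** * Commuting finite sets are not witnesses *)

Lemma leq_card_cover (T : choiceType) (A B C : {fset T}) :
  (A `<=` B `|` C)%fset -> #|` A| <= #|` B| + #|` C|.
Proof.
by move=> /fsubset_leq_card /leq_trans; apply; rewrite cardfsU leq_subr.
Qed.

Lemma card_translate (G : groupType) (k : G) (F : {fset G}) :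
  #|` translate k F| = #|` F|.
Proof. by rewrite card_imfset //=; apply: mulgI. Qed.

Lemma card_diff_sym (T : choiceType) (A B : {fset T}) :
  #|` A| = #|` B| -> #|` A `\` B|%fset = #|` B `\` A|%fset.
Proof. by move=> eqAB; rewrite !cardfsD eqAB fsetIC. Qed.

(** Products of powers of the members of a list, with exponents below m. *)
Fixpoint box (G : groupType) (s : seq G) (m : nat) : seq G :=
  if s is k :: s' then [seq (k ^+ i * y)%g | i <- iota 0 m, y <- box s' m]
  else [:: 1%g].

Lemma size_box (G : groupType) (s : seq G) m : size (box s m) = m ^ size s.
Proof.
by elim: s => //= k s IHs; rewrite size_allpairs size_iota IHs expnS.
Qed.

Lemma box_consP (G : groupType) (k : G) (s : seq G) m x :
  reflect (exists i y, [/\ i < m, y \in box s m & x = (k ^+ i * y)%g])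
          (x \in box (k :: s) m).
Proof.
apply: (iffP allpairsP) => [[[i y] [/= im ys ->]]|[i [y [im ys ->]]]].
  by exists i, y; rewrite mem_iota in im.
by exists (i, y); rewrite /= mem_iota.
Qed.

Lemma box_le (G : groupType) (s : seq G) m n :
  m <= n -> {subset box s m <= box s n}.
Proof.
move=> le_mn; elim: s => // k s IHs _ /box_consP[i [y [im ys ->]]].
by apply/box_consP; exists i, y; rewrite IHs // (leq_trans im).
Qed.

Lemma box_mul (G : groupType) (s : seq G) m k x :
  {in s &, forall a b, commute a b} -> k \in s -> x \in box s m ->
  (k * x)%g \in box s m.+1.
Proof.
elim: s x => // l s IHs x com ks /box_consP[i [y [im ys ->]]].
have coml : {in s &, forall a b, commute a b}.
  by move=> a b ain bin; apply: com; rewrite inE ?ain ?bin orbT.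
have [->|neq_kl] := eqVneq k l.
  apply/box_consP; exists i.+1, y.
  by rewrite expgS mulgA (box_le (leqnSn m)).
have {}ks : k \in s by move: ks; rewrite inE (negPf neq_kl).
have cki : commute k (l ^+ i).
  by apply: commuteX; apply: com; rewrite inE ?eqxx ?ks ?orbT.
apply/box_consP; exists i, (k * y)%g; rewrite IHs // ltnW //.
by rewrite mulgA cki mulgA.
Qed.

Lemma linear_lt_exp d c : exists t, t * d + c < 2 ^ t.
Proof.
pose s := (2 * d + c); exists (s + s); rewrite expnD.
have := ltn_expl s (isT : 1 < 2); rewrite -/s => lt_s.
have : s.+1 * s.+1 <= 2 ^ s * 2 ^ s by apply: leq_mul.
apply: leq_trans; have -> : (s + s) * d = s * (2 * d) by lia.
have : s * (2 * d) <= s * s by rewrite leq_mul2l leq_addr orbT.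
by have : c <= s := leq_addl _ _; clearbody s; rewrite mulSn mulnS; lia.
Qed.

(** The boxes of a commuting set have polynomial size, whereas the isoperimetric
    inequality would make them grow exponentially. *)
Lemma commuting_not_W_BT (G : groupType) (K : {fset G}) :
  {in K &, forall a b, commute a b} -> ~ W_BT K.
Proof.
move=> com /W_BTE[n Hn].
pose F m : {fset G} := [fset x in box K m]%fset.
have cardF m : #|` F m| <= m ^ #|` K|.
  by rewrite card_fseq -size_box size_undup.
have growth m : 0 < #|` F m| -> #|` F m| * n.+2 <= #|` F m.+1| * n.+1.
  rewrite cardfs_gt0 => /eqP F0; have [k kK le_n] := Hn _ F0.
  rewrite -(card_diff_sym (card_translate k _)) in le_n.
  have sub : (F m `|` (translate k (F m) `\` F m) `<=` F m.+1)%fset.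
    apply/fsubsetP => x; rewrite !inE => /orP[|/andP[_ /imfsetP[y /= yF ->]]].
      exact/box_le.
    by rewrite inE /= in yF; apply: box_mul.
  have dis : (F m `&` (translate k (F m) `\` F m) = fset0)%fset.
    by apply/fsetP => x; rewrite in_fsetI in_fsetD in_fset0; case: (x \in F m).
  by have := fsubset_leq_card sub; rewrite cardfsU dis cardfs0 subn0; nia.
have F_gt0 m : 0 < #|` F m.+1|.
  rewrite cardfs_gt0; apply/fset0Pn; exists 1%g; rewrite inE /=.
  have : 1%g \in box K 1; last exact: box_le.
  elim: (K : seq G) => [|k s IHs]; first by rewrite inE.
  apply/box_consP; exists 0, 1%g.
  by rewrite mulg1.
have mono m j : #|` F m.+1| <= #|` F (m.+1 + j)|.
  by apply/fsubset_leq_card/fsubsetP => x; rewrite !inE; apply/box_le/leq_addr.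
(* Growth by a factor 1 + 1/n.+1 at each step doubles the size in n.+1 steps. *)
have bernoulli m j : #|` F m.+1| * (n.+1 + j) <= #|` F (m.+1 + j)| * n.+1.
  elim: j => [|j IHj]; first by rewrite !addn0.
  have := growth (m.+1 + j) (F_gt0 _); have := mono m j; rewrite !addnS.
  by move: IHj; set u := #|` _|; set v := #|` _|; nia.
have double m : #|` F m.+1| * 2 <= #|` F (m.+1 + n.+1)|.
  have := bernoulli m n.+1; nia.
have exponential j : 2 ^ j <= #|` F (j * n.+1).+1|.
  elim: j => [|j IHj]; first exact: F_gt0.
  have -> : (j.+1 * n.+1).+1 = (j * n.+1).+1 + n.+1 by lia.
  by apply: leq_trans (double _); rewrite expnSr leq_mul2r IHj orbT.
(* Compare 2 ^ (2 ^ t) with (2 ^ t * n.+1 + 1) ^ d <= 2 ^ ((t + n.+2) * d). *)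
pose d := #|` K|; have [t lt_t] := linear_lt_exp d (n.+2 * d).
have := leq_trans (exponential (2 ^ t)) (cardF _); rewrite leqNgt => /negP; apply.
have le_base : (2 ^ t * n.+1).+1 <= 2 ^ (t + n.+2).
  rewrite expnD; have := ltn_expl n.+2 (isT : 1 < 2).
  have : 0 < 2 ^ t by rewrite expn_gt0.
  nia.
apply: (@leq_ltn_trans ((2 ^ (t + n.+2)) ^ d)); last first.
  by rewrite -expnM ltn_exp2l // mulnDl.
by rewrite -/d; case: (posnP d) => [->|d_gt0]; rewrite ?expn0 ?leq_exp2r.
Qed.

(** * Groups of reduced words *)

(** Letters are pairs (x, e) standing for x or its formal inverse. *)
Definition linv (X : Type) (l : X * bool) := (l.1, ~~ l.2).

Arguments linv : simpl never.

Lemma linvK X : involutive (@linv X).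
Proof. by case=> x e; rewrite /linv negbK. Qed.

Lemma linv_neq (X : eqType) (l : X * bool) : linv l != l.
Proof. by case: l => x []; rewrite /linv xpair_eqE eqxx. Qed.

(** No letter is followed by its inverse. *)
Definition reduced (X : eqType) : pred (seq (X * bool)) :=
  sorted (fun l m => m != linv l).

(** Left multiplication of a reduced word by a letter; the product of two
    reduced words u and v is [foldr (@push X) v u]. *)
Definition push (X : eqType) (l : X * bool) (w : seq (X * bool)) :=
  if w is m :: w' then if m == linv l then w' else l :: w else [:: l].

Lemma push_reduced (X : eqType) (l : X * bool) w :
  reduced w -> reduced (push l w).
Proof.
case: w => //= m w; case: ifP => [_|ml] pw; first exact: path_sorted pw.
by rewrite /= ml.
Qed.

Lemma pushK (X : eqType) (l : X * bool) w :
  reduced w -> push (linv l) (push l w) = w.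
Proof.
case: w => [|m w] /=; first by rewrite linvK eqxx.
case: ifP => [/eqP -> | _ _] /=; last by rewrite linvK eqxx.
by case: w => //= n w /andP[nm _]; rewrite (negPf nm).
Qed.

Lemma foldr_push_reduced (X : eqType) (u v : seq (X * bool)) :
  reduced v -> reduced (foldr (@push X) v u).
Proof. by move=> rv; elim: u => //= l u; apply: push_reduced. Qed.

Lemma foldr_push_cat (X : eqType) (u v : seq (X * bool)) :
  reduced (u ++ v) -> foldr (@push X) v u = u ++ v.
Proof.
elim: u => //= l u IHu puv; rewrite (IHu (path_sorted puv)).
by case: (u ++ v) puv => //= m w /andP[/negPf -> _].
Qed.

Lemma foldr_push_push (X : eqType) (l : X * bool) v w :
  reduced w -> foldr (@push X) w (push l v) = push l (foldr (@push X) w v).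
Proof.
move=> rw; case: v => //= m v; case: ifP => // /eqP ->.
by rewrite -{1}[l]linvK pushK // foldr_push_reduced.
Qed.

Lemma foldr_pushA (X : eqType) (u v w : seq (X * bool)) :
  reduced w ->
  foldr (@push X) w (foldr (@push X) v u)
    = foldr (@push X) (foldr (@push X) w v) u.
Proof. by move=> rw; elim: u => //= l u IHu; rewrite foldr_push_push // IHu. Qed.

(** The formal inverse of a word. *)
Definition seq_inv (X : Type) (u : seq (X * bool)) := rev (map (@linv X) u).

Lemma seq_invK X : involutive (@seq_inv X).
Proof.
by move=> u; rewrite /seq_inv map_rev revK -map_comp (eq_map (@linvK X)) map_id.
Qed.

Lemma seq_inv_reduced (X : eqType) (u : seq (X * bool)) :
  reduced u -> reduced (seq_inv u).
Proof.
rewrite /reduced /seq_inv rev_sorted sorted_map; apply: sub_sorted => l m /=.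
by rewrite linvK eq_sym.
Qed.

Lemma seq_inv_cons (X : eqType) (l : X * bool) u w :
  foldr (@push X) w (seq_inv (l :: u))
    = foldr (@push X) (push (linv l) w) (seq_inv u).
Proof. by rewrite /seq_inv /= rev_cons foldr_rcons. Qed.

Lemma seq_mulV (X : eqType) (u : seq (X * bool)) : foldr (@push X) u (seq_inv u) = [::].
Proof. by elim: u => //= l u IHu; rewrite seq_inv_cons /= linvK eqxx. Qed.

(** The free group on a set X, as the group of reduced words. *)
Record word (X : eqType) := Word {wval :> seq (X * bool); wvalP : reduced wval}.

HB.instance Definition _ (X : eqType) := [isSub for @wval X].
HB.instance Definition _ (X : choiceType) := [Choice of word X by <:].

Section WordGroup.
Context {X : choiceType}.
Implicit Types u v w : word X.

Definition word1 : word X := @Word X [::] isT.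
Definition word_mul u v : word X := Word (foldr_push_reduced u (wvalP v)).
Definition word_inv u : word X := Word (seq_inv_reduced (wvalP u)).

Lemma word_mulA : associative word_mul.
Proof. by move=> u v w; apply: val_inj; rewrite /= foldr_pushA ?wvalP. Qed.

Lemma word_mul1 : left_id word1 word_mul.
Proof. by move=> u; apply: val_inj. Qed.

Lemma word_mulr1 : right_id word1 word_mul.
Proof. by move=> u; apply: val_inj; rewrite /= foldr_push_cat ?cats0 ?wvalP. Qed.

Lemma word_mulV : left_inverse word1 word_inv word_mul.
Proof. by move=> u; apply: val_inj; rewrite /= seq_mulV. Qed.

Lemma word_mulrV : right_inverse word1 word_inv word_mul.
Proof.
move=> u; have {1}-> : u = word_inv (word_inv u) by apply: val_inj; rewrite /= seq_invK.
exact: word_mulV.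
Qed.

HB.instance Definition _ :=
  isGroup.Build (word X) word_mulA word_mul1 word_mulr1 word_mulV word_mulrV.
End WordGroup.

(** The Gromov product based at the unit: length of the longest common prefix. *)
Fixpoint lcp (T : eqType) (u v : seq T) : nat :=
  if u is x :: u' then
    if v is y :: v' then if x == y then (lcp u' v').+1 else 0 else 0
  else 0.

Lemma lcpC (T : eqType) (u v : seq T) : lcp u v = lcp v u.
Proof.
elim: u v => [|x u IHu] [|y v] //=; rewrite eq_sym; case: eqP => // _.
by rewrite IHu.
Qed.

(** The ultrametric inequality, which expresses that the Cayley graph is a
    tree. *)
Lemma lcp_min (T : eqType) (u v w : seq T) : minn (lcp u v) (lcp v w) <= lcp u w.
Proof.
elim: u v w => [|x u IHu] [|y v] [|z w] //=; rewrite ?minn0 ?min0n //.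
have [<-|_] := eqVneq x y; last by rewrite min0n.
by case: (x == z); rewrite ?minn0 // minnSS ltnS.
Qed.

Lemma lcp_size (T : eqType) (u v : seq T) : lcp u v <= size u.
Proof. by elim: u v => [|x u IHu] [|y v] //=; case: eqP => // _; apply: IHu. Qed.

Lemma take_lcp (T : eqType) n (u v : seq T) :
  n <= lcp u v -> take n u = take n v.
Proof.
elim: u v n => [|x u IHu] [|y v] [|n] //=; case: eqP => // -> le_n.
by rewrite (IHu v).
Qed.

Lemma lcp_take (T : eqType) n (u v : seq T) : lcp u (take n v) = minn n (lcp u v).
Proof.
elim: v u n => [|y v IHv] [|x u] [|n] //=; rewrite ?minn0 ?min0n //.
by case: eqP => _; rewrite ?minn0 // IHv minnSS.
Qed.

Lemma lcpxx (T : eqType) (u : seq T) : lcp u u = size u.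
Proof. by elim: u => //= x u ->; rewrite eqxx. Qed.

Lemma lcp_nth (T : eqType) x0 (u v : seq T) i : i < lcp u v -> nth x0 u i = nth x0 v i.
Proof.
by elim: u v i => [|x u IHu] [|y v] [|i] //=; case: eqP => // _; apply: IHu.
Qed.

(** The distance of u and v in the Cayley tree, that is, the length of
    u^-1 * v, in terms of the longest common prefix. *)
Lemma seq_dist (X : eqType) (u v : seq (X * bool)) :
  reduced u -> reduced v ->
  size (foldr (@push X) v (seq_inv u)) + 2 * lcp u v = size u + size v.
Proof.
elim: u v => [|l u IHu] [|m v] ru rv.
- by [].
- by rewrite /= muln0 addn0.
- rewrite foldr_push_cat cats0 ?seq_inv_reduced //.
  by rewrite /seq_inv size_rev size_map muln0 addn0.
rewrite seq_inv_cons /= linvK eq_sym; case: eqP => [_|/eqP lm].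
  by have := IHu v (path_sorted ru) (path_sorted rv); lia.
have -> : foldr (@push X) (linv l :: m :: v) (seq_inv u) = seq_inv (l :: u) ++ (m :: v).
  rewrite foldr_push_cat -cat_rcons.
    by rewrite /seq_inv /= rev_cons.
  have : reduced (seq_inv (l :: u)) by apply: seq_inv_reduced.
  rewrite /seq_inv /= rev_cons cat_rcons.
  by case: (rev _) => [|k s] /=; rewrite ?cat_path /= ?rcons_path ?linvK;
    [|case/andP => -> ->]; rewrite eq_sym lm.
by rewrite size_cat /seq_inv size_rev size_map /=; lia.
Qed.

(** The length of a group element, for the generators X. *)
Definition wlen (X : choiceType) (u : word X) : nat := size u.

Lemma wlen_dist (X : choiceType) (u v : word X) :
  wlen (u^-1 * v)%g + 2 * lcp u v = wlen u + wlen v.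
Proof. exact: seq_dist (wvalP u) (wvalP v). Qed.

Lemma wlen1 (X : choiceType) : wlen (1%g : word X) = 0.
Proof. by []. Qed.

Lemma wlen_eq0 (X : choiceType) (u : word X) : wlen u = 0 -> u = 1%g.
Proof. by move/size0nil => u0; apply: val_inj. Qed.

Lemma wlenV (X : choiceType) (u : word X) : wlen u^-1%g = wlen u.
Proof. by rewrite /wlen /= /seq_inv size_rev size_map. Qed.

Lemma wlenM (X : choiceType) (u v : word X) : wlen (u * v)%g <= wlen u + wlen v.
Proof. by have := wlen_dist u^-1%g v; rewrite invgK wlenV => <-; apply: leq_addr. Qed.

(** * Powers and common prefixes of reduced words *)

(** A nontrivial reduced word cannot cancel half of itself in its square: the
    middle letter would be its own inverse, or the two middle letters would
    be mutually inverse. *)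
Lemma wlen_sqr (X : choiceType) (u : word X) : u != 1%g -> wlen u < wlen (u * u)%g.
Proof.
move=> u1; have := wlen_dist u^-1%g u; rewrite invgK wlenV.
set n := wlen u; set c := lcp _ _ => dist_u.
suff lt_cn : 2 * c < n by move: dist_u lt_cn; clear; set d := wlen _; lia.
have n_gt0 : 0 < n by rewrite lt0n; apply: contraNN u1 => /eqP/wlen_eq0 ->.
(* Otherwise position i, in the middle of u, lies in the cancelled part: its
   letter is the inverse of the letter at position n - i.+1, which is i or i.+1. *)
rewrite ltnNge; apply/negP => le_c; pose i := n.-1./2.
have lt_ic : i < c by rewrite /i; clear -n_gt0 le_c; lia.
have [l _] : exists l, l \in (u : seq _).
  move: n_gt0; rewrite /n /wlen; case: (u : seq _) => // l s _.
  by exists l; rewrite mem_head.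
have szu : size u = n by [].
have lt_in : n - i.+1 < n by clear -n_gt0; lia.
have lt_i : i < n by clear -n_gt0; rewrite /i; lia.
have := lcp_nth l lt_ic.
rewrite /= /seq_inv nth_rev ?size_map szu // (nth_map l) ?szu //.
have : n - i.+1 = i \/ n - i.+1 = i.+1 by clear -n_gt0; rewrite /i; lia.
case=> Ei; move: lt_in; rewrite Ei => lt_in /eqP; first by rewrite (negPf (linv_neq _)).
have /(sortedP l)/(_ i) := wvalP u; rewrite szu => /(_ lt_in).
by move=> /negP nl /eqP el; apply: nl; rewrite -el linvK.
Qed.

(** Powers of a nontrivial word have strictly increasing lengths: the length
    of u ^ k is a convex function of k by the ultrametric inequality. *)
Lemma wlen_expS (X : choiceType) (u : word X) k :
  u != 1%g ->
  wlen (u ^+ k)%g < wlen (u ^+ k.+1)%g /\ (0 < k -> wlen u <= wlen (u ^+ k)%g).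
Proof.
move=> u1; elim: k => [|k [IH1 IH2]].
  split=> //; rewrite expg0 expg1 wlen1 lt0n.
  by apply: contraNN u1 => /eqP/wlen_eq0 ->.
have le_u : wlen u <= wlen (u ^+ k.+1)%g.
  by case: k IH1 IH2 => [|k] IH1 IH2 //; apply: leq_trans (IH2 isT) (ltnW IH1).
split=> // {le_u}; have [->|k_gt0] := posnP k; first exact: wlen_sqr.
have lt_uk := leq_ltn_trans (IH2 k_gt0) IH1.
have := lcp_min u (u ^+ k.+1)%g (u ^+ k.+2)%g.
have E m : (u^-1 * u ^+ m.+1 = u ^+ m)%g by rewrite expgS mulKg.
have E' m : ((u ^+ m)^-1 * u ^+ m.+1 = u)%g by rewrite expgSr mulKg.
have := wlen_dist u (u ^+ k.+2)%g; rewrite E.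
have := wlen_dist u (u ^+ k.+1)%g; rewrite E.
have := wlen_dist (u ^+ k.+1)%g (u ^+ k.+2)%g; rewrite E'.
move: IH1 lt_uk; clear; set d := wlen u; set p := wlen (u ^+ k)%g.
set q := wlen (u ^+ k.+1)%g; set r := wlen (u ^+ k.+2)%g.
set x := lcp _ _; set y := lcp _ _; set z := lcp _ _; lia.
Qed.

Lemma wlen_exp_ge (X : choiceType) (u : word X) k :
  u != 1%g -> wlen u + k <= wlen (u ^+ k.+1)%g.
Proof.
move=> u1; elim: k => [|k IHk]; first by rewrite addn0.
by rewrite addnS; apply: leq_ltn_trans IHk _; case: (wlen_expS k.+1 u1).
Qed.

(** Along an orbit of a, consecutive points branch off near the unit only for
    exponents in a window of bounded width. *)
Lemma branch_window (X : choiceType) (a w : word X) L i j :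
  a != 1%g -> i < j ->
  lcp (a ^+ i * w)%g (a ^+ i.+1 * w)%g < L ->
  lcp (a ^+ j * w)%g (a ^+ j.+1 * w)%g < L -> j - i <= 2 * L + 1.
Proof.
move=> a1 lt_ij lt_i lt_j; pose u := (w^-1 * a * w)%g.
have u1 : u != 1%g.
  apply: contraNN a1 => /eqP u1; apply/eqP/(mulIg w)/(mulgI w^-1%g).
  by rewrite mul1g mulVg mulgA.
have expu k : (u ^+ k = w^-1 * a ^+ k * w)%g.
  elim: k => [|k IHk]; first by rewrite !expg0 mulg1 mulVg.
  by rewrite expgSr IHk /u expgSr !mulgA mulgK.
have dist m n : m <= n ->
    ((a ^+ m * w)^-1 * (a ^+ n * w) = u ^+ (n - m))%g.
  move=> le_mn; rewrite expu invgM -{1}(subnKC le_mn) expgnDr.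
  by rewrite !mulgA; congr (_ * _ * _)%g; rewrite -mulgA mulVg mulg1.
pose x m := (a ^+ m * w)%g; have [k Ek] : exists k, j = i + k.+1.
  by exists (j - i).-1; lia.
(* Here k.+1 = j - i.  The sums |x_i| + |x_i.+1| and |x_j| + |x_j.+1| are small by
   hypothesis; regrouped as |x_i| + |x_j.+1| and |x_i.+1| + |x_j|, they bound the
   lengths of u ^ k.+2 and u ^ k by the triangle inequality. *)
have di := wlen_dist (x i) (x i.+1); rewrite dist // subSnn expg1 in di.
have dj := wlen_dist (x j) (x j.+1); rewrite dist // subSnn expg1 in dj.
have dij := wlen_dist (x i) (x j.+1).
rewrite dist in dij; last by clear -lt_ij; lia.
have dji := wlen_dist (x i.+1) (x j); rewrite dist // in dji.
have E1 : j.+1 - i = k.+2 by clear -Ek; lia.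
have E2 : j - i.+1 = k by clear -Ek; lia.
rewrite E1 in dij; rewrite E2 in dji.
have g1 := wlen_exp_ge k.+1 u1.
have -> : j - i = k.+1 by clear -Ek; lia.
have [->|k_gt0] := posnP k; first by rewrite addn1.
have g2 : wlen u + k <= (wlen (u ^+ k)%g).+1.
  by case: (k) k_gt0 => // l _; rewrite addnS ltnS wlen_exp_ge.
move: lt_i lt_j di dj dij dji g1 g2; rewrite -/(x i) -/(x i.+1) -/(x j) -/(x j.+1).
clear; move: (wlen (x i)) (wlen (x j)) (wlen (x i.+1)) (wlen (x j.+1)) => wi wj wi1 wj1.
move: (lcp (x i) _) (lcp (x j) _) (lcp (x i) _) (lcp (x i.+1) _).
move: (wlen _) (wlen _) (wlen _); lia.
Qed.

(** The prefix of length n of a reduced word. *)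
Definition word_take (X : choiceType) n (w : word X) : word X :=
  Word (take_sorted n (wvalP w)).

Lemma wlen_take (X : choiceType) n (w : word X) :
  wlen (word_take n w) = minn n (wlen w).
Proof. by rewrite /wlen /= size_take_min. Qed.

(** Left multiplication by a carries the long prefixes of w to prefixes of
    a * w. *)
Lemma mul_word_take (X : choiceType) (a w : word X) n :
  wlen a <= n -> n <= wlen w ->
  (a * word_take n w)%g = word_take (n + wlen (a * w)%g - wlen w) (a * w)%g.
Proof.
move=> le_an le_nw; set v := (a * _)%g; set z := (a * w)%g.
have size_n : wlen (word_take n w) = n by rewrite wlen_take (minn_idPl le_nw).
have size_v := wlen_dist a^-1%g (word_take n w).
have size_z := wlen_dist a^-1%g w.
rewrite invgK wlenV in size_v; rewrite invgK wlenV in size_z.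
have le_lcp : lcp (a^-1)%g w <= wlen a by rewrite -wlenV; apply: lcp_size.
rewrite /= lcp_take (minn_idPr (leq_trans le_lcp le_an)) -/v in size_v.
have size_vz := wlen_dist v z.
rewrite invgM mulgA mulgVK in size_vz.
have := wlen_dist (word_take n w) w; rewrite lcpC /= lcp_take lcpxx.
rewrite (minn_idPl le_nw) => dist_n.
have Ev : n + wlen z - wlen w = wlen v.
  move: size_v size_z; rewrite -/z size_n; clear.
  by move: (wlen _) (wlen _) (wlen _) (wlen _) (lcp _ _); lia.
have Ez : lcp v z = wlen v.
  move: size_vz dist_n Ev le_nw; rewrite size_n.
  by move: (wlen _) (wlen _) (wlen _) (wlen _) (lcp _ _); lia.
rewrite Ev; apply: val_inj => /=.
by rewrite -(@take_lcp _ (wlen v) v z) ?Ez // take_size.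
Qed.

(** If w shares a long prefix with both a * w and b * w, then a and b shift
    this prefix along itself, and shifts commute. *)
Lemma long_lcp_commute (X : choiceType) (a b w : word X) M :
  wlen a <= M -> wlen b <= M ->
  4 * M <= lcp w (a * w)%g -> 4 * M <= lcp w (b * w)%g -> commute a b.
Proof.
move=> le_a le_b le_wa le_wb.
have le_w : 4 * M <= wlen w by apply: leq_trans le_wa (lcp_size _ _).
have shift (c : word X) n : wlen c <= M -> 4 * M <= lcp w (c * w)%g ->
    M <= n -> n <= 3 * M ->
    (c * word_take n w)%g = word_take (n + wlen (c * w)%g - wlen w) w.
  move=> le_c le_wc le_n1 le_n2; rewrite mul_word_take; last 2 first.
  - exact: leq_trans le_c le_n1.
  - by move: le_w le_n2; clear; move: (wlen _); lia.
  apply: val_inj; apply/esym/take_lcp/(leq_trans _ le_wc).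
  have := wlenM c w; move: le_c le_n2; clear.
  by move: (wlen _) (wlen _) (wlen _); lia.
have bound (c : word X) : wlen c <= M ->
   wlen (c * w)%g <= M + wlen w /\ wlen w <= M + wlen (c * w)%g.
  move=> le_c; have := wlenM c w; have := wlenM c^-1%g (c * w)%g.
  rewrite mulKg wlenV; move: le_c; clear.
  by move: (wlen _) (wlen _) (wlen _); lia.
have [la1 la2] := bound a le_a; have [lb1 lb2] := bound b le_b.
(* The prefix of length 2 M stays, after one shift by at most M, between the
   lengths M and 3 M where both shifts are defined. *)
apply: (mulIg (word_take (2 * M) w)); rewrite -!mulgA.
have s1 := shift b (2 * M) le_b le_wb; have s2 := shift a (2 * M) le_a le_wa.
rewrite s1; [|lia..]; rewrite s2; [|lia..].
rewrite (shift a) // ?(shift b) //; last 4 first.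
- by move: la2; clear; move: (wlen _) (wlen _); lia.
- by move: la1; clear; move: (wlen _) (wlen _); lia.
- by move: lb2; clear; move: (wlen _) (wlen _); lia.
- by move: lb1; clear; move: (wlen _) (wlen _); lia.
congr word_take; move: la1 la2 lb1 lb2; clear.
by move: (wlen _) (wlen _) (wlen _); lia.
Qed.

(** * Noncommuting elements give witnesses *)

Lemma multiplicative1 (G H : groupType) (f : {multiplicative G -> H}) : f 1%g = 1%g.
Proof. by apply: (mulgI (f 1%g)); rewrite -gmulfM !mulg1. Qed.

Lemma multiplicativeX (G H : groupType) (f : {multiplicative G -> H}) n :
  {morph f : x / (x ^+ n)%g}.
Proof.
by move=> x; elim: n => [|n IHn]; rewrite ?multiplicative1 // !expgS gmulfM IHn.
Qed.

(** A set of integers of diameter at most C has at most C.+1 members. *)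
Lemma leq_sum_window (P : pred nat) C N :
  (forall i j, P i -> P j -> i < j -> j - i <= C) ->
  \sum_(i < N) P i <= C.+1.
Proof.
move=> HP; rewrite -(big_mkord xpredT (fun i => nat_of_bool (P i))).
rewrite -big_mkcond /= sum1_count -size_filter.
case: (filter _ _) (filter_uniq P (iota_uniq 0 (N - 0)))
    (fun i => mem_filter P i (iota 0 (N - 0))) => // i0 s us ms.
have [i Pi min_i] : exists2 i, P i & forall j, P j -> i <= j.
  have exP : exists i, P i.
    by exists i0; have := ms i0; rewrite mem_head => /esym/andP[].
  by exists (ex_minn exP); case: ex_minnP.
rewrite -(size_iota i C.+1); apply: uniq_leq_size => // j.
rewrite ms => /andP[Pj _]; rewrite mem_iota.
have := min_i j Pj; rewrite leq_eqVlt => /orP[/eqP <-|lt_ij]; first by lia.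
by have := HP i j Pi Pj lt_ij; lia.
Qed.

Lemma translateM (G : groupType) (a b : G) F :
  translate (a * b)%g F = translate a (translate b F).
Proof.
apply/fsetP => x; apply/imfsetP/imfsetP => /= -[y yF ->].
  by exists (b * y)%g; rewrite ?mulgA //; apply/imfsetP; exists y.
by case/imfsetP: yF => /= z zF ->; exists z; rewrite ?mulgA.
Qed.

Lemma in_translate_mul (G : groupType) (a : G) F x :
  ((a * x)%g \in translate a F) = (x \in F).
Proof.
by apply/imfsetP/idP => /= [[y yF /mulgI ->]|xF] //; exists x.
Qed.

Lemma card_diff_translateX (G : groupType) (a : G) (F : {fset G}) i :
  #|` F `\` translate (a ^+ i)%g F|%fset <= i * #|` F `\` translate a F|%fset.
Proof.
elim: i => [|i IHi].
  rewrite leqn0 cardfs_eq0 fsetD_eq0; apply/fsubsetP => x xF.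
  by apply/imfsetP; exists x; rewrite //= mul1g.
rewrite mulSn; apply: leq_trans (leq_add (leqnn _) IHi).
rewrite -(card_translate a (F `\` translate (a ^+ i)%g F)%fset).
apply: leq_card_cover; apply/fsubsetP => x; rewrite in_fsetU !in_fsetD.
rewrite expgS translateM => /andP[xN ->]; rewrite andbT.
case: (boolP (x \in translate a F)) => //= /imfsetP[/= y yF eq_x].
by rewrite eq_x in_translate_mul in xN *; rewrite in_translate_mul in_fsetD xN.
Qed.

(** Mass transport along the orbits of a: if each orbit segment of length N
    meets P at most C times and F is almost a-invariant, then P is rare in F. *)
Lemma orbit_count (G : groupType) (P : pred G) (a : G) (F : {fset G}) N C :
  (forall g, \sum_(i < N) P (a ^+ i * g)%g <= C) ->
  N * #|` [fset g in F | P g]%fset|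
    <= C * #|` F| + N * N * #|` F `\` translate a F|%fset.
Proof.
move=> HC.
have cardP (Q : pred G) : #|` [fset g in F | Q g]%fset| = \sum_(g <- F) Q g.
  rewrite -big_mkcond /= sum1_count -size_filter.
  apply/perm_size/uniq_perm; rewrite ?filter_uniq ?fset_uniq // => g.
  by rewrite mem_filter !inE andbC.
have sumC : \sum_(i < N) #|` [fset g in F | P (a ^+ i * g)%g]%fset| <= C * #|` F|.
  under eq_bigr do rewrite cardP; rewrite exchange_big /=.
  have -> : C * #|` F| = \sum_(g <- F) C.
    by rewrite big_const_seq count_predT iter_addn_0.
  by apply: leq_sum.
have step (i : 'I_N) : #|` [fset g in F | P g]%fset| <=
    #|` [fset g in F | P (a ^+ i * g)%g]%fset| + N * #|` F `\` translate a F|%fset.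
  rewrite -[X in _ <= X + _](card_translate (a ^+ i)%g).
  apply: (@leq_trans (#|` translate (a ^+ i)%g [fset g in F | P (a ^+ i * g)%g]%fset| +
    #|` F `\` translate (a ^+ i)%g F|%fset)).
    apply: leq_card_cover; apply/fsubsetP => x; rewrite in_fsetU in_fsetD !inE /=.
    case/andP=> xF Px; rewrite xF andbT orbC.
    case: (boolP (x \in translate _ F)) => //= /imfsetP[/= y yF eq_x].
    by rewrite eq_x in_translate_mul !inE /= yF -eq_x.
  rewrite leq_add2l; apply: leq_trans (card_diff_translateX _ _ _) _.
  by rewrite leq_mul2r ltnW ?orbT.
have : \sum_(i < N) #|` [fset g in F | P g]%fset| <=
    \sum_(i < N) (#|` [fset g in F | P (a ^+ i * g)%g]%fset|
                    + N * #|` F `\` translate a F|%fset).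
  by apply: leq_sum => i _; apply: step.
rewrite big_split /= !sum_nat_const card_ord mulnA => /leq_trans; apply.
by rewrite leq_add2r.
Qed.

(** Two elements of K whose images in a free group do not commute make K a
    witness of the paradox. *)
Lemma noncommuting_W_BT (G : groupType) (X : choiceType)
    (theta : {multiplicative G -> word X}) (K : {fset G}) (a b : G) :
  a \in K -> b \in K -> ~ commute (theta a) (theta b) -> W_BT K.
Proof.
move=> aK bK nab.
pose M := maxn (wlen (theta a)) (wlen (theta b)); pose L := 4 * M.
pose P c g := lcp (theta g) (theta (c * g)%g) < L.
have Pab g : P a g || P b g.
  rewrite /P !ltnNge -negb_and; apply/negP => /andP[].
  rewrite !gmulfM => la lb; apply: nab.
  exact: long_lcp_commute (leq_maxl _ _) (leq_maxr _ _) la lb.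
pose C := (2 * L + 1).+1; pose N := 4 * C.
have window c g : theta c != 1%g -> \sum_(i < N) P c (c ^+ i * g)%g <= C.
  move=> c1; apply: (leq_sum_window (P := fun i => P c (c ^+ i * g)%g)).
  move=> i j Pi Pj lt_ij.
  by apply: (@branch_window _ (theta c) (theta g) L i j) => //;
    [move: Pi | move: Pj]; rewrite /P mulgA -expgS !gmulfM !multiplicativeX.
have a1 : theta a != 1%g.
  by apply/eqP => a1; apply: nab; rewrite a1 /commute mul1g mulg1.
have b1 : theta b != 1%g.
  by apply/eqP => b1; apply: nab; rewrite b1 /commute mul1g mulg1.
(* With N = 4 C and #|F `\` a F| < #|F| / (4 N), the bound of [orbit_count] gives
   fewer than #|F| / 2 elements of F satisfying P a. *)
apply/W_BTE; exists (4 * N).-1 => F F0.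
have F_gt0 : 0 < #|` F| by rewrite cardfs_gt0; apply/eqP.
have -> : (4 * N).-1.+1 = 4 * N by rewrite /N /C; lia.
case: (leqP #|` F| (4 * N * #|` F `\` translate a F|%fset)) => [|lt_a]; first by exists a.
case: (leqP #|` F| (4 * N * #|` F `\` translate b F|%fset)) => [|lt_b]; first by exists b.
have Ha := orbit_count F (fun g => window a g a1).
have Hb := orbit_count F (fun g => window b g b1).
have cover : #|` F| <= #|` [fset g in F | P a g]%fset| + #|` [fset g in F | P b g]%fset|.
  apply/leq_card_cover/fsubsetP => g gF; rewrite !inE /= gF /=; exact: Pab.
have C_gt0 : 0 < C by [].
move: Ha Hb cover lt_a lt_b F_gt0 C_gt0; rewrite /N; clear; clearbody C.
move: #|` F| #|` (F `\` translate a F)%fset| #|` (F `\` translate b F)%fset|.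
move: #|` [fset g in F | P a g]%fset| #|` [fset g in F | P b g]%fset|.
move=> p q f da db; nia.
Qed.

(** * Free and fully residually free groups *)

(** A group that is free in the sense of the universal property embeds in a
    group of reduced words: the evaluation of words is a left inverse of the
    canonical morphism, by uniqueness. *)
Lemma free_group_embed (F : groupType) :
  free_group F ->
  exists (X : choiceType) (phi : {multiplicative F -> word X}), injective phi.
Proof.
case=> X0 [iota univ].
(* Equality and choice on the basis are supplied classically. *)
pose X : choiceType := {classic X0}.
have [phi phi_iota _] := univ (word X) (fun x => @Word X [:: (x : X, true)] isT).
exists X, phi.
pose letter (l : X * bool) : F := if l.2 then iota l.1 else (iota l.1)^-1%g.
pose eval (w : word X) : F := foldr (fun l g => letter l * g)%g 1%g w.
have letterV l g : (letter l * (letter (linv l) * g) = g)%g.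
  by case: l => x []; rewrite /letter /= ?mulKg ?mulVKg.
have eval_mul : {morph eval : u v / (u * v)%g}.
  move=> u v; rewrite /eval /=; elim: (u : seq _) => [|l s IHs] /=; first by rewrite mul1g.
  rewrite -mulgA -{}IHs; case: (foldr (@push X) v s) => //= m t.
  by case: eqP => //= ->; rewrite letterV.
pose evalM := isMultiplicative.Build _ _ eval eval_mul.
pose psi : {multiplicative word X -> F} := HB.pack eval evalM.
have [chi chi_iota chi_unique] := univ F iota.
have psiK : cancel phi psi.
  move=> g; rewrite -[RHS]/(idfun g) -[LHS]/((psi \o phi) g).
  rewrite (chi_unique [the {multiplicative F -> F} of psi \o phi]) => [|x].
    by rewrite (chi_unique [the {multiplicative F -> F} of idfun]).
  by rewrite /= phi_iota /psi /= /eval /= mulg1.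
exact: can_inj psiK.
Qed.

Lemma fully_residually_free_W_BT (G : groupType) (K : {fset G}) (a b : G) :
  fully_residually_free G -> a \in K -> b \in K -> (a * b <> b * a)%g -> W_BT K.
Proof.
move=> frf aK bK nab.
have [g|F [phi [freeF _ phi1]]] := frf [:: ((a * b)^-1 * (b * a))%g].
  rewrite inE => /eqP -> /(congr1 (fun x => (a * b) * x)%g).
  by rewrite mulVKg mulg1 => /esym.
have [X [psi inj]] := free_group_embed freeF.
apply: (noncommuting_W_BT (theta := [the {multiplicative G -> word X} of psi \o phi]) aK bK).
rewrite /commute /= -!gmulfM => /inj eq_ab; apply: (phi1 _ (mem_head _ _)).
by rewrite gmulfM -eq_ab -gmulfM mulVg multiplicative1.
Qed.

Theorem theorem3 (G : groupType) (nu : nat -> G) :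
  numbering nu -> computable_group nu ->
  sigma02 (index_set nu (@W_BT G)) /\
  (fully_residually_free G -> computable (index_set nu (@W_BT G))).
Proof.
move=> nu_surj /computable_group_table[M tM]; split; first exact: sigma02_W_BT tM.
move=> frf; have [b rb Hb] := computable_noncommuting nu_surj tM.
exists b => // t; rewrite -Hb /index_set; set K := imfset _ _ _; split.
  move=> W; apply: contrapT => com; apply: (commuting_not_W_BT _ W).
  by move=> x y xK yK; apply: contrapT => nxy; apply: com; exists x, y.
by case=> x [y [xK yK nxy]]; apply: fully_residually_free_W_BT nxy.
Qed.
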